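(* Let $\Pi=(\pi^t)_{t\in\mathbb{Z}}$ be an allowable sequence of $b+r$ points, $b$ of them blue and $r$ of them red, with $b\ge r$ and $b+r$ even. Then $\Pi$ has at least $r$ distinct balanced transpositions.
   Context: Let $P$ be a set of $n=b+r$ points, the disjoint union of a set $B$ of $b$ blue points and a set $R$ of $r$ red points. An allowable sequence on $P$ is a doubly infinite sequence $\Pi=(\pi^t)_{t\in\mathbb{Z}}$ of permutations of $P$ (each written as a left-to-right list of all points of $P$) such that, for every integer $t$: (1) $\pi^{t}$ is obtained from $\pi^{t-1}$ by a transposition $\tau_t$ of two points that are consecutive in $\pi^{t-1}$; and (2) $\pi^{t+\binom{n}{2}}$ is the reverse permutation of $\pi^t$. (Consequently $\pi^{t+2\binom{n}{2}}=\pi^t$ for every $t$. Such a sequence arises from a planar point set in general position by recording the order of the orthogonal projections of the points onto a rotating directed line.) Each blue point has weight $+1$ and each red point has weight $-1$. Put $\delta:=(b-r)/2$. A transposition $\tau_t: pq\to qp$ (meaning $p$ is immediately to the left of $q$ in $\pi^{t-1}$ and $q$ is immediately to the left of $p$ in $\pi^t$) is balanced if (i) one of $p,q$ is blue and the other is red; and (ii) the sum of the weights of the points to the left of the pair $pq$ in $\pi^{t-1}$ is $\delta$ (equivalently, since the total weight is $2\delta$, the sum of the weights of the points to the right of the pair is $\delta$). The transposition $\tau_t$ is balanced if and only if $\tau_{t+\binom n2}$, which swaps the same two points, is balanced. Balanced transpositions are counted as distinct when they swap distinct unordered pairs of points, i.e. they are counted within a halfperiod of $\binom n2$ consecutive transpositions.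 *)

(* Defs.v *)
From mathcomp Require Import all_boot all_order all_algebra.
From mathcomp Require Import boolp.

Set Implicit Arguments.
Unset Strict Implicit.
Unset Printing Implicit Defensive.

Import GRing.Theory.
Local Open Scope ring_scope.

Section AllowableSequences.

Variable P : finType.

(* [s'] is obtained from [s] by swapping the consecutive points [p], [q],
   which have exactly the points of [u] to their left in [s]. *)
Definition swaps (s s' u : seq P) (p q : P) : Prop :=
  exists v : seq P, s = u ++ [:: p, q & v] /\ s' = u ++ [:: q, p & v].

Definition allowable (pi : int -> seq P) : Prop :=
  [/\ forall t : int, perm_eq (pi t) (enum P),
      forall t : int, exists u p q, swaps (pi (t - 1)) (pi t) u p q
    & forall t : int, pi (t + 'C(#|P|, 2)%:Z) = rev (pi t)].

(* The blue points are those of [B], the red ones those of [~: B]. *)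
Variable B : {set P}.

Definition weight (x : P) : int := if x \in B then 1 else - 1.

(* The integer division is exact as soon as #|P| is even. *)
Definition delta : int := ((#|B|%:Z - #|~: B|%:Z) %/ 2)%Z.

Definition balanced (pi : int -> seq P) (t : int) (p q : P) : Prop :=
  exists u : seq P,
    [/\ swaps (pi (t - 1)) (pi t) u p q,
        (p \in B) != (q \in B)
      & \sum_(x <- u) weight x = delta].

(* Balanced transpositions are distinguished by the unordered pair of points
   they swap, so the set of these pairs is what is counted. *)
Definition balanced_pairs (pi : int -> seq P) : {set {set P}} :=
  [set e : {set P} |
    `[< exists t p q, balanced pi t p q /\ e = [set p; q] >]].

End AllowableSequences.

(* Main.v *)
Require Import Defs.
From mathcomp Require Import all_boot all_order all_algebra perm.
From mathcomp Require Import boolp zify.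

Set Implicit Arguments.
Unset Strict Implicit.
Unset Printing Implicit Defensive.

Import GRing.Theory Num.Theory.

(** Let T be the total weight, so that delta = T / 2.  Call a point of a
    permutation high if the weights of the prefixes that end just before it and
    just after it add up to more than T, and low otherwise; the sum and T have
    different parity, so the sum is never T.  Reading the letters high and low
    from left to right turns a permutation into a word.  A swap changes the word
    exactly when it is balanced, and then it turns over two adjacent equal
    letters, one of a red and one of a blue point (above_swap, above_pair).
    Reversing a permutation reverses and complements its word (above_rev).

    A valley is a place where a low letter is followed by a high one.  The two
    points there are blue (above_rise), so a red point can pass from one side of
    a valley to the other only when the valley itself moves.  If a valley can be
    followed through a half period and arrives at the mirror image of its first
    place, then every red point has changed sides.  A valley may vanish, however:
    a balanced swap next to it can turn over the letters that bound it.  It then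
    rolls through the equal letters to the next valley, and many red points may
    change sides at the cost of one balanced swap.  The remedy is to count as
    misplaced the red points that are high and left of the valley or low and
    right of it.  Each red point passed in a long roll ceases to be misplaced, so
    in each step the number of red points that change sides, plus the increase
    of the number of misplaced ones, is at most 1, and at most 0 if the swap is
    not balanced (crossing_step).  The number of misplaced points is the same at
    both ends of the half period by symmetry, whence at least r balanced swaps
    (transport).

    It remains to find a path of valleys that is symmetric in this sense.
    Rolling through a half period and then taking the mirror image is an
    antitone map on the valleys of a given time.  A valley that it fixes is what
    is needed.  If there is none at any time, then this map sends some valleys
    to the right and the others to the left, the former all lying before the
    latter, and exactly one peak (a high letter followed by a low one) lies
    between the two kinds.  That peak follows a symmetric path, and with time
    reversed and the colours exchanged it moves by rolling
    (symmetric_boundary).  In this case transport gives at least b balanced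
    swaps.

    Distinct swaps of a half period exchange distinct pairs of points, because
    there are as many swaps as pairs and every pair has to be reversed
    (swapped_pairs_inj). *)

(** * Valleys and peaks of words *)

(** A word is a function on positions with true for a high letter; the cut z
    lies between the letters z and z.+1. *)
Definition valley (w : nat -> bool) z := ~~ w z && w z.+1.

Definition peak (w : nat -> bool) z := w z && ~~ w z.+1.

(** What happens to a former valley z when the word has become w: it slides
    down a slope of w. *)
Definition roll (w : nat -> bool) z z' :=
  (z <= z' /\ forall j, z < j <= z' -> ~~ w j) \/
  (z' <= z /\ forall j, z' < j <= z -> w j).

Lemma rise_between (w : nat -> bool) a b :
  a < b -> ~~ w a -> w b -> exists2 z, a <= z < b & valley w z.
Proof.
elim: b => // b IH lt_ab wa wb1.
have [wb|nwb] := boolP (w b); last by exists b; rewrite /valley ?nwb ?wb1 //; lia.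
have lt_ab' : a < b.
  by rewrite ltn_neqAle -ltnS lt_ab andbT; apply: contraNneq wa => ->.
by have [z hz vz] := IH lt_ab' wa wb; exists z => //; lia.
Qed.

Lemma fall_between (w : nat -> bool) a b :
  a < b -> w a -> ~~ w b -> exists2 z, a <= z < b & peak w z.
Proof.
move=> lt_ab wa wb.
have [|||z hz] := @rise_between (fun j => ~~ w j) a b => //; first by rewrite negbK.
by rewrite /valley negbK; exists z.
Qed.

Lemma roll_exists (w : nat -> bool) n z :
  ~~ w 0 -> w n.+1 -> z <= n -> exists2 z', valley w z' & roll w z z'.
Proof.
move=> w0 wn le_zn; have [wz|nwz] := boolP (w z).
  have ex_a : exists a, (a <= z) && ~~ w a by exists 0; rewrite w0 leq0n.
  have [a /andP[le_az nwa] amax] := ex_maxnP ex_a (fun i => fun h => proj1 (andP h)).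
  have up j : a < j <= z -> w j.
    move=> hj; apply/negPn/negP => nwj; have := amax j.
    by rewrite nwj; lia.
  have lt_az : a < z by rewrite ltn_neqAle le_az andbT; apply: contraNneq nwa => ->.
  exists a; first by rewrite /valley nwa up //; lia.
  by right; split.
have ex_b : exists b, (z <= b) && w b.+1 by exists n; rewrite le_zn.
have [b /andP[le_zb wb] bmin] := ex_minnP ex_b.
have down j : z <= j <= b -> ~~ w j.
  case: j => [//|j] hj; have [->|ne] := eqVneq j.+1 z => //.
  by apply/negP => wj; have := bmin j; rewrite wj; lia.
exists b; first by rewrite /valley down // le_zb leqnn.
by left; split=> // j hj; apply: down; lia.
Qed.

(** Away from a peak there is only one way down.  At a peak there are two, which
    is why this case is excluded. *)
Lemma roll_unique (w : nat -> bool) z a b :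
  ~~ peak w z -> valley w a -> valley w b -> roll w z a -> roll w z b -> a = b.
Proof.
have right c d : valley w c ->
    (forall j, z < j <= d -> ~~ w j) -> z <= c -> d <= c.
  move=> /andP[_ wc] low le_zc; rewrite leqNgt; apply/negP => lt_cd.
  by have := low c.+1; rewrite wc; lia.
have left c d : valley w c ->
    (forall j, d < j <= z -> w j) -> c <= z -> c <= d.
  move=> /andP[wc _] high le_cz; rewrite leqNgt; apply/negP => lt_dc.
  by have := high c; rewrite (negbTE wc); lia.
move=> npeak va vb.
have opp c d : valley w c -> valley w d ->
    z <= c -> (forall j, z < j <= c -> ~~ w j) ->
    d <= z -> (forall j, d < j <= z -> w j) -> c = d.
  move=> vc vd le_zc low le_dz high.
  have [eq_zc|ne_zc] := eqVneq z c.
    by apply/eqP; rewrite eqn_leq (left _ _ vc high) ?eq_zc // -eq_zc le_dz.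
  have [eq_zd|ne_zd] := eqVneq z d.
    by apply/eqP; rewrite eqn_leq (right _ _ vd low) -?eq_zd.
  by case/negP: npeak; rewrite /peak high ?low //; lia.
move=> [[le_a la]|[le_a ha]] [[le_b lb]|[le_b hb]].
- by apply/eqP; rewrite eqn_leq (right b a) ?(right a b).
- exact: opp.
- by apply/esym/opp.
- by apply/eqP; rewrite eqn_leq (left b a) ?(left a b).
Qed.

(** * A symmetric path of valleys or of peaks *)

(** The letters 1, ..., n of the word at time t are those of the n points.  The
    low letter 0 and the high letters after n ensure that there always is a
    valley, and that rolling never leaves the word. *)
Section SymmetricBoundary.
Variables (W : nat -> nat -> bool) (n N : nat).
Hypothesis W_low : forall t, ~~ W t 0.
Hypothesis W_high : forall t j, n < j -> W t j.
Hypothesis W_step : forall t, W t.+1 =1 W t \/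
  exists k, W t k = W t k.+1 /\
    forall j, W t.+1 j = W t j (+) ((j == k) || (j == k.+1)).
Hypothesis W_mirror : forall t j, j <= n.+1 -> W (t + N) j = ~~ W t (n.+1 - j).

Lemma valley_le t z : valley (W t) z -> z <= n.
Proof.
by case/andP=> wz _; rewrite leqNgt; apply: contra wz => /(W_high t).
Qed.

Lemma valley_mirror t z : z <= n -> valley (W (t + N)) (n - z) = valley (W t) z.
Proof.
move=> le_zn; rewrite /valley !W_mirror; try lia.
have -> : n.+1 - (n - z) = z.+1 by lia.
have -> : n.+1 - (n - z).+1 = z by lia.
by rewrite negbK andbC.
Qed.

Lemma peak_mirror t e : e <= n -> peak (W (t + N)) (n - e) = peak (W t) e.
Proof.
move=> le_zn; rewrite /peak !W_mirror; try lia.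
have -> : n.+1 - (n - e) = e.+1 by lia.
have -> : n.+1 - (n - e).+1 = e by lia.
by rewrite negbK andbC.
Qed.

Lemma roll_mirror t z z' : z <= n -> z' <= n ->
  roll (W t) z z' -> roll (W (t + N)) (n - z) (n - z').
Proof.
move=> le_zn le_z'n [[le low]|[le high]]; [right|left]; split; try lia.
  by move=> j hj; rewrite W_mirror ?low //; lia.
by move=> j hj; rewrite W_mirror ?negbK ?high //; lia.
Qed.

(** A step turns over equal letters, so it cannot turn over both letters at a
    valley. *)
Lemma valley_not_peak t z : valley (W t) z -> ~~ peak (W t.+1) z.
Proof.
case/andP=> wz wz1; apply/negP => /andP[].
case: (W_step t) => [-> //|]; first by rewrite (negbTE wz).
move=> [k [wk flip]]; rewrite !flip (negbTE wz) wz1 /=.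
move=> hz hz1; have eq_zk : z = k by lia.
by move: wk; rewrite -eq_zk (negbTE wz) wz1.
Qed.

Definition rolls_to (f : nat -> nat -> nat) := forall t z, valley (W t) z ->
  valley (W t.+1) (f t z) /\ roll (W t.+1) z (f t z).

Lemma rolling_exists : exists f, rolls_to f.
Proof.
have /choice[f fP] : forall tz : nat * nat, exists z', valley (W tz.1) tz.2 ->
    valley (W tz.1.+1) z' /\ roll (W tz.1.+1) tz.2 z'.
  move=> [t z] /=; have [vz|] := boolP (valley (W t) z); last by exists 0.
  have [||//|z' ? ?] := @roll_exists (W t.+1) n z; first exact: W_low.
  - exact: W_high.
  - exact: valley_le vz.
  by exists z'.
by exists (fun t z => f (t, z)) => t z; apply: (fP (t, z)).
Qed.

Variable f : nat -> nat -> nat.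
Hypothesis fP : rolls_to f.

(** Two valleys roll past each other only if a letter at each of them is turned
    over: the high letter u.+1 and the low letter v, or two high or two low
    letters that are not adjacent.  A step turns over two adjacent equal letters,
    so it does none of these. *)
Lemma rolling_homo t u v : valley (W t) u -> valley (W t) v -> u <= v ->
  f t u <= f t v.
Proof.
rewrite leq_eqVlt => vu vv /predU1P[-> //|lt_uv].
have [_ ru] := fP vu; have [_ rv] := fP vv.
have [/andP[wu wu1] /andP[wv wv1]] := (vu, vv).
have lt_u1v : u.+1 < v.
  by rewrite ltn_neqAle lt_uv andbT; apply: contraTneq wu1 => ->.
rewrite leqNgt; apply/negP => lt_f.
have [eqW|[k [wk flip]]] := W_step t.
  case: ru => [[le_u low]|[le_u _]].
    have [eq_u|ne_u] := eqVneq u (f t u); last first.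
      by have := low u.+1; rewrite eqW wu1; lia.
    case: rv => [[le_v _]|[le_v high]]; first lia.
    by have := high v; rewrite eqW (negbTE wv); lia.
  case: rv => [[le_v _]|[le_v high]]; first lia.
  by have := high v; rewrite eqW (negbTE wv); lia.
have fliplow j : j <= f t u -> u < j -> W t j -> (j == k) || (j == k.+1).
  case: ru => [[le_u low]|[le_u _]] le_jf lt_uj wj; last lia.
  by have := low j; rewrite flip wj; lia.
have fliphigh j : f t v < j -> j <= v -> ~~ W t j -> (j == k) || (j == k.+1).
  case: rv => [[le_v _]|[le_v high]] lt_fj le_jv wj; first lia.
  by have := high j; rewrite flip (negbTE wj); lia.
have le_fu : f t u <= v.
  rewrite leqNgt; apply/negP => lt_vf.
  by have := fliplow u.+1; have := fliplow v.+1; rewrite wu1 wv1; lia.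
have le_fv : u <= f t v.
  rewrite leqNgt; apply/negP => lt_fu.
  by have := fliphigh u; have := fliphigh v; rewrite wu wv; lia.
have hu : (u.+1 == k) || (u.+1 == k.+1) by apply: fliplow => //; lia.
have hv : (v == k) || (v == k.+1) by apply: fliphigh => //; lia.
have [eq_k eq_v] : k = u.+1 /\ v = k.+1 by lia.
by move: wk; rewrite -eq_v eq_k wu1 (negbTE wv).
Qed.

Lemma rolling_mirror t z : valley (W t) z -> f (t + N) (n - z) = n - f t z.
Proof.
move=> vz; have [vf rf] := fP vz.
have [le_z le_f] := (valley_le vz, valley_le vf).
have vmz : valley (W (t + N)) (n - z) by rewrite valley_mirror.
have [vfm rfm] := fP vmz.
apply: (@roll_unique (W (t + N).+1) (n - z)) => //; first exact: valley_not_peak.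
  by rewrite -addSn valley_mirror.
by rewrite -addSn; apply: roll_mirror.
Qed.

Fixpoint track t k z := if k is k'.+1 then f (t + k') (track t k' z) else z.

Lemma track_valley t k z : valley (W t) z -> valley (W (t + k)) (track t k z).
Proof.
by elim: k => [|k IH] vz /=; rewrite ?addn0 // addnS; case: (fP (IH vz)).
Qed.

Lemma track_homo t k u v : valley (W t) u -> valley (W t) v -> u <= v ->
  track t k u <= track t k v.
Proof.
by elim: k => //= k IH vu vv le_uv; apply: rolling_homo; rewrite ?track_valley ?IH.
Qed.

Lemma track_mirror t k z : valley (W t) z ->
  track (t + N) k (n - z) = n - track t k z.
Proof.
elim: k => //= k IH vz; rewrite IH // addnAC rolling_mirror //.
exact: track_valley.
Qed.

Lemma trackSr t k z : track t k.+1 z = track t.+1 k (f t z).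
Proof. by elim: k => /= [|k <-]; rewrite ?addn0 // addnS. Qed.

(** Mirroring the end of the track gives a cut of the word at the starting time,
    so this is a map from the valleys at time t to themselves. *)
Definition half_turn t z := n - track t N z.

Lemma half_turn_valley t z : valley (W t) z -> valley (W t) (half_turn t z).
Proof.
move=> vz; have vt := track_valley N vz; have le := valley_le vt.
by rewrite -valley_mirror ?leq_subr // /half_turn subKn.
Qed.

Lemma half_turn_homo t u v : valley (W t) u -> valley (W t) v -> u <= v ->
  half_turn t v <= half_turn t u.
Proof. by move=> vu vv le_uv; apply/leq_sub2l/track_homo. Qed.

Lemma half_turn_rolling t z : valley (W t) z ->
  half_turn t.+1 (f t z) = f t (half_turn t z).
Proof.
move=> vz; have vi := half_turn_valley vz.
have := rolling_mirror vi; rewrite /half_turn subKn ?(valley_le (track_valley N vz)) //.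
rewrite -trackSr /= => ->; rewrite subKn //.
by apply: (@valley_le t.+1); case: (fP vi).
Qed.

Lemma half_turn_mirror t z : valley (W t) z ->
  half_turn (t + N) (n - z) = n - half_turn t z.
Proof. by move=> vz; rewrite /half_turn track_mirror. Qed.

Section NoFixedPoint.
Hypothesis no_fix : forall t z, valley (W t) z -> half_turn t z != z.

(** The peak e is a watershed: the half turn moves the valleys before it to the
    right and the valleys after it to the left. *)
Definition splits t e := peak (W t) e /\
  forall z, valley (W t) z -> (z < half_turn t z) = (z < e).

Lemma splits_exists t : exists e, splits t e.
Proof.
pose heads_right z := valley (W t) z && (z < half_turn t z).
have [z0 _ vz0] : exists2 z, 0 <= z < n.+1 & valley (W t) z.
  by apply: rise_between => //; apply: W_high.
(* A valley that is moved to the left has an image that is moved to the right,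
   since the half turn reverses the order. *)
have ex_a : exists a, heads_right a.
  have vi := half_turn_valley vz0; have nf := no_fix vz0.
  have [lt|gt|eq] := ltngtP z0 (half_turn t z0).
  - by exists z0; rewrite /heads_right vz0.
  - exists (half_turn t z0); rewrite /heads_right vi /= ltn_neqAle eq_sym no_fix //=.
    by apply: half_turn_homo => //; lia.
  - by rewrite -eq eqxx in nf.
have [|a /andP[va lt_ai] amax] := @ex_maxnP heads_right n ex_a.
  by move=> i /andP[/valley_le].
have [wa wa1] := andP va; have [wi _] := andP (half_turn_valley va).
have lt_a1i : a.+1 < half_turn t a.
  by rewrite ltn_neqAle lt_ai andbT; apply: contraTneq wa1 => ->.
(* The last valley that is moved to the right is followed by another valley,
   namely its image, hence by a peak; the first such peak is the watershed. *)
have ex_e : exists e, (a < e) && peak (W t) e.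
  have [e he pe] := fall_between lt_a1i wa1 wi.
  by exists e; rewrite pe andbT; lia.
have [e /andP[lt_ae pe] emin] := ex_minnP ex_e.
have high j : a < j <= e -> W t j.
  move=> hj; apply/negPn/negP => wj.
  have lt_a1j : a.+1 < j.
    by rewrite ltn_neqAle (andP hj).1 andbT; apply: contraTneq wa1 => ->.
  have [e' he' pe'] := fall_between lt_a1j wa1 wj.
  by have := emin e'; rewrite pe'; lia.
exists e; split=> // z vz; have [lt_ze|le_ez] := ltnP z e.
  have le_za : z <= a.
    rewrite leqNgt; apply/negP => lt_az; case/andP: vz => + _.
    by rewrite high // lt_az ltnW.
  by apply: (leq_ltn_trans le_za (leq_trans lt_ai _)); apply: half_turn_homo.
apply/negbTE/negP => lt_zi; have := amax z; rewrite /heads_right vz lt_zi; lia.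
Qed.

Lemma splits_unique t e e' : splits t e -> splits t e' -> e = e'.
Proof.
have no_lt x y : splits t x -> splits t y -> ~~ (x < y).
  move=> [px sx] [py sy]; apply/negP => lt_xy.
  have [[wx wx1] [wy _]] := (andP px, andP py).
  have lt_x1y : x.+1 < y.
    by rewrite ltn_neqAle lt_xy andbT; apply: contraNneq wx1 => ->.
  have [z hz vz] := rise_between lt_x1y wx1 wy.
  by have := sx z vz; rewrite sy //; lia.
by move=> se se'; have := no_lt e e' se se'; have := no_lt e' e se' se; lia.
Qed.

Lemma peak_le t e : peak (W t) e -> e <= n.
Proof.
case/andP=> _ we; rewrite leqNgt; apply: contra we => lt_ne.
by apply: W_high; lia.
Qed.

Lemma splits_mirror t e : splits t e -> splits (t + N) (n - e).
Proof.
move=> [pe se]; have le_en := peak_le pe.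
split=> [|z vz]; first by rewrite peak_mirror.
have le_zn := valley_le vz.
have vmz : valley (W t) (n - z) by rewrite -valley_mirror ?leq_subr // subKn.
have eq_z : z = n - (n - z) by rewrite subKn.
have := half_turn_mirror vmz; rewrite -eq_z => ->.
have le_in := valley_le (half_turn_valley vmz).
have ne_ze : z != n - e.
  apply/eqP => eq_ze; have eq_e : n - z = e by lia.
  by move: vmz; rewrite eq_e /valley; case/andP: pe => ->.
have := se _ vmz; have := no_fix vmz; lia.
Qed.

(** A valley of time t between the two watersheds would have to roll across the
    new one, since rolling preserves the side of the watershed.  A peak cannot be
    rolled over, so there is no such valley, and the word of time t is constant
    on the way from e' to e. *)
Lemma splits_roll t e e' : splits t e -> splits t.+1 e' ->
  roll (fun j => ~~ W t j) e' e.
Proof.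
move=> [/andP[we we1] se] [/andP[we' we'1] se'].
have side z : valley (W t) z -> (f t z < e') = (z < e).
  move=> vz; have [vf _] := fP vz; rewrite -se // -se' // half_turn_rolling //.
  have vi := half_turn_valley vz; have [vfi _] := fP vi.
  have := no_fix vf; rewrite half_turn_rolling //; have := no_fix vz.
  have [lt|gt|//] := ltngtP z (half_turn t z) => _.
    by have := rolling_homo vz vi (ltnW lt); lia.
  by have := rolling_homo vi vz (ltnW gt); lia.
have [le_ee'|le_e'e] := leqP e e'.
  right; split=> // j hj; apply/negP => wj.
  have lt_e1j : e.+1 < j.
    by rewrite ltn_neqAle (andP hj).1 andbT; apply: contraNneq we1 => ->.
  have [z hz vz] := rise_between lt_e1j we1 wj.
  have [_ [[le low]|[le _]]] := fP vz; have := side z vz; try lia.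
  have [eq_f|ne] := eqVneq (f t z) e'; last by have := low e'; rewrite we'; lia.
  by case: (fP vz) => /andP[]; rewrite eq_f we'.
left; split=> [|j hj]; first lia.
rewrite negbK; apply/negPn/negP => wj.
have lt_je : j < e.
  by rewrite ltn_neqAle (andP hj).2 andbT; apply: contraNneq wj => ->.
have [z hz vz] := rise_between lt_je wj we.
have [_ [[le _]|[le high]]] := fP vz; have := side z vz; try lia.
by have := high e'.+1; rewrite (negbTE we'1); lia.
Qed.

End NoFixedPoint.

End SymmetricBoundary.

(** The peak path rolls backwards in time and in the complemented word, hence
    the order of e t.+1 and e t. *)
Theorem symmetric_boundary (W : nat -> nat -> bool) (n N : nat) :
  (forall t, ~~ W t 0) ->
  (forall t j, n < j -> W t j) ->
  (forall t, W t.+1 =1 W t \/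
     exists k, W t k = W t k.+1 /\
       forall j, W t.+1 j = W t j (+) ((j == k) || (j == k.+1))) ->
  (forall t j, j <= n.+1 -> W (t + N) j = ~~ W t (n.+1 - j)) ->
  (exists t (z : nat -> nat), z N = n - z 0 /\ forall i,
     valley (W (t + i)) (z i) /\ roll (W (t + i).+1) (z i) (z i.+1)) \/
  (exists e : nat -> nat, e N = n - e 0 /\ forall t,
     peak (W t) (e t) /\ roll (fun j => ~~ W t j) (e t.+1) (e t)).
Proof.
move=> W_low W_high W_step W_mirror.
have [f fP] := rolling_exists W_low W_high.
have [[t [z [vz fix_z]]]|no_fix] :=
    pselect (exists t z, valley (W t) z /\ half_turn n N f t z = z).
  left; exists t, (fun i => track f t i z); split=> [|i].
    have := valley_le W_high (track_valley fP N vz).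
    by rewrite /half_turn in fix_z; rewrite /=; lia.
  have vi := track_valley fP i vz; split=> //; exact: (fP _ _ vi).2.
right.
have nf t z : valley (W t) z -> half_turn n N f t z != z.
  by move=> vz; apply/eqP => fix_z; apply: no_fix; exists t, z.
have /choice[e eP] := splits_exists W_low W_high W_step W_mirror fP nf.
exists e; split=> [|t]; last first.
  split; first by case: (eP t).
  exact: (splits_roll W_high W_step W_mirror fP nf (eP t) (eP t.+1)).
apply: (splits_unique (eP N)).
exact: (splits_mirror W_high W_step W_mirror fP nf (eP 0)).
Qed.

(** * The word of a permutation *)

(** The colouring c and the number d stand for blue and delta.  They are kept
    arbitrary because the second half of the argument exchanges the colours and
    changes the sign of delta. *)
Section Prefixes.
Local Open Scope ring_scope.
Variables (P : finType) (c : pred P).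

Definition colour_weight x : int := if c x then 1 else - 1.
Definition prefix_weight (s : seq P) i : int := \sum_(x <- take i s) colour_weight x.

Variable d : int.

(** The two prefixes are those that end next to the point in position i.  Their
    weights differ by 1, so the sum is never d + d, and complementing the
    inequality gives a strict one again. *)
Definition above s i : bool := d + d < prefix_weight s i + prefix_weight s i.+1.

Lemma prefix_weightS x0 s i : (i < size s)%N ->
  prefix_weight s i.+1 = prefix_weight s i + colour_weight (nth x0 s i).
Proof.
move=> lt_i.
by rewrite /prefix_weight (take_nth x0 lt_i) -cats1 big_cat /= big_seq1.
Qed.

Lemma prefix_weight_size s : prefix_weight s (size s) = \sum_(x <- s) colour_weight x.
Proof. by rewrite /prefix_weight take_size. Qed.

Lemma prefix_weight_perm s s' : perm_eq s s' ->
  prefix_weight s (size s) = prefix_weight s' (size s').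
Proof. by move=> eq_s; rewrite !prefix_weight_size; apply: perm_big. Qed.

Lemma prefix_weight_cat u s :
  prefix_weight (u ++ s) (size u) = \sum_(x <- u) colour_weight x.
Proof. by rewrite /prefix_weight take_size_cat. Qed.

Lemma prefix_weight_rev s i : (i <= size s)%N ->
  prefix_weight (rev s) i = prefix_weight s (size s) - prefix_weight s (size s - i).
Proof.
move=> le_i; rewrite /prefix_weight take_rev take_size big_rev.
rewrite -[X in _ = \sum_(x <- X) _ - _](cat_take_drop (size s - i)).
by rewrite big_cat addrC addKr.
Qed.

Lemma above_rev s i : prefix_weight s (size s) = d + d -> (i < size s)%N ->
  above (rev s) i = ~~ above s (size s - i.+1).
Proof.
move=> tot lt_i; rewrite /above !prefix_weight_rev ?(ltnW lt_i) // tot.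
have [x0 _] : exists x0, x0 \in s.
  by case: s lt_i {tot} => // x s _; exists x; rewrite inE eqxx.
have -> : (size s - i = (size s - i.+1).+1)%N by lia.
rewrite (prefix_weightS x0); last lia.
by rewrite /colour_weight; case: (c _); lia.
Qed.

Section Swap.
Variables (u v : seq P) (p q : P).
Let k := size u.
Let s := u ++ [:: p, q & v].
Let s' := u ++ [:: q, p & v].

Lemma prefix_weight_swap i : prefix_weight s' i =
  prefix_weight s i + (if i == k.+1 then colour_weight q - colour_weight p else 0).
Proof.
rewrite /prefix_weight /s /s' !take_cat -/k; case: ltnP => [lt_ik|le_ki].
  by have -> : (i == k.+1) = false by [lia]; rewrite addr0.
rewrite -[in i == _](subnKC le_ki) -addn1 eqn_add2l.
case: (i - k)%N => [|[|m]] /=; rewrite !big_cat /= ?big_nil ?addr0 //.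
  by rewrite !big_seq1 -addrA [colour_weight p + _]addrC subrK.
by rewrite !big_cons (addrCA (colour_weight p)).
Qed.

Lemma prefix_weight_pair :
  prefix_weight s k.+1 = prefix_weight s k + colour_weight p /\
  prefix_weight s k.+2 = prefix_weight s k + colour_weight p + colour_weight q.
Proof.
have eq1 : prefix_weight s k.+1 = prefix_weight s k + colour_weight p.
  by rewrite (prefix_weightS p) ?size_cat /= ?nth_cat ?ltnn ?subnn //; lia.
split=> //; rewrite (prefix_weightS p) ?size_cat /= ?nth_cat; last lia.
by rewrite eq1 ltnNge leqnSn subSnn.
Qed.

(** The swap changes only the prefix weight between the two points, and by 2 if
    the colours differ.  This matters for the comparison with d only if the
    prefix weights on both sides of the pair are d. *)
Lemma above_swap i :
  above s' i = above s i (+)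
    [&& c p != c q, prefix_weight s k == d & (i == k) || (i == k.+1)].
Proof.
have [eq1 eq2] := prefix_weight_pair.
rewrite /above !prefix_weight_swap eqSS.
have [->|ne_k] := eqVneq i k.
  by rewrite eq1 andbT ltn_eqF // /colour_weight; case: (c p); case: (c q) => /=; lia.
have [->|ne_k1] := eqVneq i k.+1; first last.
  by rewrite !andbF addbF !addr0.
by rewrite eq1 eq2 /= !andbT /colour_weight; case: (c p); case: (c q) => /=; lia.
Qed.

Lemma above_pair : c p != c q -> above s k = above s k.+1.
Proof.
have [eq1 eq2] := prefix_weight_pair.
by rewrite /above eq1 eq2 /colour_weight; case: (c p); case: (c q) => //= _; lia.
Qed.

(** From a low to a high point the prefix weights must increase twice. *)
Lemma above_rise : ~~ above s k -> above s k.+1 -> c p && c q.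
Proof.
have [eq1 eq2] := prefix_weight_pair.
by rewrite /above eq1 eq2 /colour_weight; case: (c p); case: (c q) => //=; lia.
Qed.

End Swap.
End Prefixes.

Lemma prefix_weightN (P : finType) (c : pred P) s i :
  prefix_weight (predC c) s i = (- prefix_weight c s i)%R.
Proof.
rewrite /prefix_weight -sumrN; apply: eq_bigr => x _.
by rewrite /colour_weight /=; case: (c x); rewrite ?opprK.
Qed.

Lemma aboveN (P : finType) (c : pred P) d s i : i < size s ->
  above (predC c) (- d)%R s i = ~~ above c d s i.
Proof.
case: s => // x0 s lt_i; rewrite /above !prefix_weightN (prefix_weightS c x0) //.
by rewrite /colour_weight; case: (c _); lia.
Qed.

(** * Points that change sides of a valley *)

Section IndexSwap.
Variables (P : finType) (u v : seq P) (p q : P).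
Let s := u ++ [:: p, q & v].
Let s' := u ++ [:: q, p & v].
Hypothesis uniq_s : uniq s.

Lemma index_swap x : index x s' = index (tperm p q x) s.
Proof.
have : uniq ([:: p; q] ++ u ++ v) by rewrite uniq_catCA.
rewrite /= inE !mem_cat !negb_or => /and3P[/and3P[ne_pq pu pv] /andP[qu qv] _].
rewrite /s /s' !index_cat; case: tpermP => [->|->|].
- by rewrite (negbTE pu) (negbTE qu) /= !eqxx [q == p]eq_sym (negbTE ne_pq).
- by rewrite (negbTE pu) (negbTE qu) /= !eqxx.
move=> /eqP ne_xp /eqP ne_xq; case: ifP => //= _.
by rewrite ![_ == x]eq_sym (negbTE ne_xp) (negbTE ne_xq).
Qed.

Lemma index_fst : index p s = size u.
Proof.
move: uniq_s; rewrite /s cat_uniq => /and3P[_ /hasPn/(_ p) pu _].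
by rewrite index_cat (negbTE (pu _)) ?inE ?eqxx //= eqxx addn0.
Qed.

Lemma index_snd : index q s = (size u).+1.
Proof.
move: uniq_s; rewrite /s cat_uniq => /and3P[_ /hasPn/(_ q) qu /= /andP[ne_pq _]].
rewrite index_cat (negbTE (qu _)) ?inE ?eqxx ?orbT //=.
by move: ne_pq; rewrite inE negb_or eqxx => /andP[/negbTE-> _]; rewrite addn1.
Qed.

End IndexSwap.

Lemma index_rev_uniq (T : eqType) (s : seq T) x : uniq s -> x \in s ->
  index x (rev s) = size s - (index x s).+1.
Proof.
move=> uniq_s in_s; have lt_x := in_s; rewrite -index_mem in lt_x.
have lt_r : size s - (index x s).+1 < size s by lia.
rewrite -{1}(nth_index x in_s).
have -> : index x s = size s - (size s - (index x s).+1).+1 by lia.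
rewrite -nth_rev // index_uniq ?size_rev ?rev_uniq //; lia.
Qed.

Lemma roll_side (w : nat -> bool) z z' j :
  roll w z z' -> (j < z) != (j < z') -> w j.+1 = (j < z).
Proof.
move=> [[le_z low]|[le_z high]] ne_side.
  by have /low/negbTE-> : z < j.+1 <= z' by [lia]; lia.
by have /high-> : z' < j.+1 <= z by [lia]; lia.
Qed.

Lemma mirrorK n i : i < n -> n - (n - i.+1).+1 = i.
Proof. lia. Qed.

Lemma mirror_lt n i z : i < n -> z <= n -> (n - i.+1 < n - z) = ~~ (i < z).
Proof. lia. Qed.

(** In the comments of this section the points outside c are called red and
    those of c blue. *)
Section Transport.
Variables (P : finType) (c : pred P) (d : int).

(** A red point should be low left of the cut and high right of it, as all of
    them are when the cut is the only valley. *)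
Definition misplaced (s : seq P) z : nat :=
  \sum_(x | ~~ c x) ((index x s < z) == above c d s (index x s)).

Definition crossing (s s' : seq P) z z' : nat :=
  \sum_(x | ~~ c x) ((index x s < z) != (index x s' < z')).

Definition is_balanced (s u : seq P) (p q : P) : bool :=
  (c p != c q) && (prefix_weight c s (size u) == d).

(** Letters beyond the points of s are left free, so that words with different
    boundary letters can be used. *)
Definition reads (w : nat -> bool) s := forall i, i < size s -> w i.+1 = above c d s i.

(** Red points are compared by position rather than one by one: a swap of two
    red points of different letters exchanges their letters, which leaves the
    number of misplaced points unchanged although both points may be affected.
    A red point over which the cut rolls was misplaced before and is not
    afterwards, unless its letter has just been turned over; the latter happens
    to one red point, and only in a balanced swap. *)
Lemma crossing_step (s s' u v : seq P) (p q : P) (w w' : nat -> bool) z z' :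
  perm_eq s (enum P) -> s = u ++ [:: p, q & v] -> s' = u ++ [:: q, p & v] ->
  reads w s -> reads w' s' -> valley w z -> roll w' z z' ->
  crossing s s' z z' + misplaced s' z' <= misplaced s z + is_balanced s u p q.
Proof.
move=> perm_s def_s def_s' rw rw' vz rz.
have uniq_s : uniq s by rewrite (perm_uniq perm_s) enum_uniq.
have in_s x : x \in s by rewrite (perm_mem perm_s) mem_enum.
have size_s' : size s' = size s by rewrite def_s def_s' !size_cat.
have idx x : index x s' = index (tperm p q x) s.
  by rewrite def_s' def_s; apply: index_swap; rewrite -def_s.
have idx_p : index p s = size u by rewrite {1}def_s index_fst -?def_s.
have idx_q : index q s = (size u).+1 by rewrite {1}def_s (@index_snd _ u v p) -?def_s.
set k := size u in idx_p idx_q.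
have lt_idx x : index x s < size s by rewrite index_mem.
have above_s' i : above c d s' i =
    above c d s i (+) (is_balanced s u p q && ((i == k) || (i == k.+1))).
  by rewrite def_s' above_swap -def_s /is_balanced -andbA.
(* No red point is swapped across the cut. *)
have straddle : z = k.+1 -> c p && c q.
  move=> eq_z; have lt_k := lt_idx p; have lt_k1 := lt_idx q.
  rewrite idx_p in lt_k; rewrite idx_q in lt_k1.
  by case/andP: vz; rewrite eq_z !rw // def_s; apply: above_rise.
have same_side x : ~~ c x -> (index x s < z) = (index x s' < z).
  move=> cx; rewrite idx; case: tpermP => [eq_x|eq_x|//]; rewrite eq_x in cx *.
    rewrite idx_p idx_q; have [/straddle|] := eqVneq z k.+1; last lia.
    by rewrite (negbTE cx).
  rewrite idx_p idx_q; have [/straddle|] := eqVneq z k.+1; last lia.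
  by rewrite (negbTE cx) andbF.
(* The misplaced points can be counted with their new positions: if both colours
   are equal the swap permutes the red points, and otherwise the two positions
   have the same letter and lie on the same side. *)
have -> : misplaced s z =
    \sum_(x | ~~ c x) ((index x s' < z) == above c d s (index x s')).
  have [eq_c|ne_c] := eqVneq (c p) (c q).
    rewrite /misplaced (reindex_inj (@perm_inj _ (tperm p q))) /=.
    apply: eq_big => x; last by rewrite idx.
    by case: tpermP => [->|->|]; rewrite ?eq_c.
  apply: eq_bigr => x cx; rewrite -same_side // idx.
  have eq_k : above c d s k = above c d s k.+1 by rewrite def_s; apply: above_pair.
  by case: tpermP => [->|->|//]; rewrite idx_p idx_q eq_k.
(* The red point of a balanced pair. *)
pose e x := is_balanced s u p q && (x == if c p then q else p).
have le_e : \sum_(x | ~~ c x) e x <= is_balanced s u p q.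
  rewrite /e; case: (is_balanced s u p q) => /=; last by rewrite big1.
  rewrite (big_rem (if c p then q else p)) ?mem_index_enum //= eqxx.
  rewrite big1_seq; first by case: ifP.
  move=> x /andP[_]; rewrite mem_rem_uniq ?index_enum_uniq // inE.
  by case/andP=> /negbTE->.
apply: leq_trans (leq_add (leqnn _) le_e).
rewrite -!big_split /=; apply: leq_sum => x cx.
rewrite same_side //; set j := index x s'.
have lt_j : j < size s' by rewrite size_s' /j idx.
have [ej|nej] := boolP (e x).
  have := above_s' j; case/andP: ej => -> /eqP def_x.
  have -> : (j == k) || (j == k.+1).
    rewrite /j idx def_x.
    by case: (c p); rewrite ?tpermL ?tpermR ?idx_p ?idx_q eqxx ?orbT.
  by move=> ->; case: (j < z); case: (j < z'); case: (above c d s j).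
have above_j : above c d s' j = above c d s j.
  rewrite above_s'; move: nej; rewrite /e /is_balanced.
  have [eq_c|ne_c] := eqVneq (c p) (c q); first by rewrite addbF.
  case: (_ == d) => /=; last by rewrite addbF.
  move=> ne_x; suff /negbTE-> : ~~ ((j == k) || (j == k.+1)) by rewrite addbF.
  apply: contra ne_x; rewrite /j idx -idx_q -idx_p.
  have idx_inj y y' : index y s = index y' s -> y = y'.
    by move=> eq_y; rewrite -(nth_index p (in_s y)) eq_y nth_index.
  case/orP=> /eqP/idx_inj; case: tpermP => [eq_x|eq_x|ne_xp ne_xq] eq_t //.
  - by move: ne_c; rewrite eq_t eqxx.
  - by move: ne_c cx; rewrite eq_x; case: (c p); case: (c q); rewrite ?eqxx.
  - by move: ne_c cx; rewrite eq_x; case: (c p); case: (c q); rewrite ?eqxx.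
  - by move: ne_c; rewrite eq_t eqxx.
have [/eqP->|ne_side] := boolP ((j < z) == (j < z')).
  by rewrite above_j addn0 leqnn.
have eq_a : above c d s' j = (j < z).
  by rewrite -(rw' j lt_j); apply: roll_side rz ne_side.
by rewrite -above_j eq_a; case: (j < z) ne_side; case: (j < z').
Qed.

(** A symmetric path of cuts forces every red point to change sides.  The
    hypothesis on the total weight makes reversal complement the word, so that
    the numbers of misplaced points at both ends agree. *)
Theorem transport (n N : nat) (s : nat -> seq P) (w : nat -> nat -> bool)
    (z : nat -> nat) (balanced_at : nat -> bool) :
  n = #|P| -> prefix_weight c (enum P) n = (d + d)%R ->
  (forall i, perm_eq (s i) (enum P)) ->
  s N = rev (s 0) ->
  (forall i, i < N -> exists u v p q,
     [/\ s i = u ++ [:: p, q & v], s i.+1 = u ++ [:: q, p & v]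
       & balanced_at i = is_balanced (s i) u p q]) ->
  (forall i, reads (w i) (s i)) ->
  (forall i, i < N -> valley (w i) (z i) /\ roll (w i.+1) (z i) (z i.+1)) ->
  z 0 <= n -> z N = n - z 0 ->
  #|[pred x | ~~ c x]| <= \sum_(i < N) balanced_at i.
Proof.
move=> def_n tot perm_s s_rev s_swap s_word z_path le_z z_N.
have size_s i : size (s i) = n by rewrite (perm_size (perm_s i)) -cardT def_n.
have partial m : m <= N ->
    \sum_(i < m) crossing (s i) (s i.+1) (z i) (z i.+1) + misplaced (s m) (z m)
      <= misplaced (s 0) (z 0) + \sum_(i < m) balanced_at i.
  elim: m => [|m IH] lt_mN; first by rewrite !big_ord0 addn0 add0n.
  have [u [v [p [q [def_s def_s' flip_m]]]]] := s_swap m lt_mN.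
  have [vz rz] := z_path m lt_mN.
  have := crossing_step (perm_s m) def_s def_s' (s_word m) (s_word m.+1) vz rz.
  by move: (IH (ltnW lt_mN)); rewrite !big_ord_recr /= flip_m; clear; lia.
have in_s i x : x \in s i by rewrite (perm_mem (perm_s i)) mem_enum.
have lt_idx x : index x (s 0) < n by rewrite -(size_s 0) index_mem.
have idx_N x : index x (s N) = n - (index x (s 0)).+1.
  by rewrite s_rev index_rev_uniq ?size_s // (perm_uniq (perm_s 0)) enum_uniq.
have misplaced_N : misplaced (s N) (z N) = misplaced (s 0) (z 0).
  apply: eq_bigr => x _; rewrite idx_N z_N s_rev above_rev ?size_s.
  - rewrite mirrorK // mirror_lt //.
    by case: (_ < _); case: (above _ _ _ _).
  - by rewrite -(size_s 0) (prefix_weight_perm c (perm_s 0)) -cardT -def_n.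
  - by rewrite ltn_subrL (leq_trans _ (lt_idx x)).
have := partial N (leqnn N); rewrite misplaced_N addnC leq_add2l; apply: leq_trans.
rewrite /crossing exchange_big /= -sum1_card; apply: leq_sum => x _.
pose l i := index x (s i) < z i.
have l_N : l N = ~~ l 0 by rewrite /l idx_N z_N mirror_lt.
(* A boolean sequence that ends differently from how it begins changes at least
   once. *)
have change m : (l m != l 0) <= \sum_(i < m) (l i != l i.+1).
  elim: m => [|m IH]; first by rewrite eqxx.
  rewrite big_ord_recr /=; apply: leq_trans (leq_add IH (leqnn _)).
  by case: (l 0); case: (l m); case: (l m.+1).
by apply: leq_trans (change N); rewrite l_N; case: (l 0).
Qed.

End Transport.

(** * Distinct swaps of a half period exchange distinct pairs *)

Lemma order_swap (P : finType) (u v : seq P) (p q x y : P) :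
  let s := u ++ [:: p, q & v] in let s' := u ++ [:: q, p & v] in
  uniq s -> x \in s -> y \in s -> x != y -> [set p; q] != [set x; y] ->
  (index x s' < index y s') = (index x s < index y s).
Proof.
move=> s s' uniq_s in_x in_y ne_xy ne_pair.
have idx z : index z s' = index (tperm p q z) s by apply: index_swap.
have idx_p : index p s = size u by apply: index_fst.
have idx_q : index q s = (size u).+1 by apply: index_snd.
have idx_ne a b : a \in s -> b \in s -> a <> b -> index a s <> index b s.
  move=> in_a in_b ne_ab eq_ab; apply: ne_ab.
  by rewrite -(nth_index p in_a) eq_ab nth_index.
have in_p : p \in s by rewrite mem_cat !inE eqxx orbT.
have in_q : q \in s by rewrite mem_cat !inE eqxx !orbT.
rewrite !idx.
case: tpermP => [eq_x|eq_x|ne_xp ne_xq]; case: tpermP => [eq_y|eq_y|ne_yp ne_yq] //.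
- by rewrite eq_x eq_y eqxx in ne_xy.
- by rewrite eq_x eq_y eqxx in ne_pair.
- have := idx_ne _ _ in_y in_p ne_yp; have := idx_ne _ _ in_y in_q ne_yq.
  by rewrite eq_x; lia.
- by rewrite eq_x eq_y setUC eqxx in ne_pair.
- by rewrite eq_x eq_y eqxx in ne_xy.
- have := idx_ne _ _ in_y in_p ne_yp; have := idx_ne _ _ in_y in_q ne_yq.
  by rewrite eq_x; lia.
- have := idx_ne _ _ in_x in_p ne_xp; have := idx_ne _ _ in_x in_q ne_xq.
  by rewrite eq_y; lia.
- have := idx_ne _ _ in_x in_p ne_xp; have := idx_ne _ _ in_x in_q ne_xq.
  by rewrite eq_y; lia.
Qed.

(** Every pair has to be exchanged at least once in order to be reversed, and
    the number of swaps equals the number of pairs. *)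
Lemma swapped_pairs_inj (P : finType) (s u v : nat -> seq P) (p q : nat -> P) :
  let N := 'C(#|P|, 2) in
  (forall t, perm_eq (s t) (enum P)) -> s N = rev (s 0) ->
  (forall t, s t = u t ++ [:: p t, q t & v t] /\
             s t.+1 = u t ++ [:: q t, p t & v t]) ->
  injective (fun t : 'I_N => [set p t; q t]).
Proof.
move=> N perm_s s_rev s_swap.
have uniq_s t : uniq (s t) by rewrite (perm_uniq (perm_s t)) enum_uniq.
have in_s t x : x \in s t by rewrite (perm_mem (perm_s t)) mem_enum.
have size_s t : size (s t) = #|P| by rewrite (perm_size (perm_s t)) -cardT.
have swapped x y : x != y -> exists2 t, t < N & [set p t; q t] = [set x; y].
  move=> ne_xy; apply: contrapT => never.
  have same m : m <= N ->
      (index x (s m) < index y (s m)) = (index x (s 0) < index y (s 0)).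
    elim: m => // m IH lt_mN; rewrite -(IH (ltnW lt_mN)).
    have [def_s def_s'] := s_swap m.
    rewrite def_s' def_s; apply: order_swap; rewrite -?def_s ?in_s ?uniq_s //.
    by apply/eqP => eq_pair; apply: never; exists m.
  have := same N (leqnn N); rewrite s_rev !index_rev_uniq ?size_s //.
  have ne_idx : index x (s 0) <> index y (s 0).
    move=> eq_idx; case/eqP: ne_xy.
    by rewrite -(nth_index x (in_s 0 x)) eq_idx nth_index.
  have := in_s 0 x; have := in_s 0 y; rewrite -!index_mem !size_s; lia.
set f := fun t : 'I_N => _.
suff /imset_injP inj_f : #|f @: [set: 'I_N]| == #|[set: 'I_N]|.
  by move=> t1 t2; apply: inj_f; rewrite inE.
rewrite eqn_leq leq_imset_card cardsT card_ord.
have {1}-> : N = #|[set A : {set P} | #|A| == 2]| by rewrite card_draws.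
apply/subset_leq_card/subsetP => A; rewrite inE => /cards2P[x [y [ne_xy ->]]].
have [t lt_t <-] := swapped x y ne_xy.
by apply/imsetP; exists (Ordinal lt_t).
Qed.

(** * Balanced swaps of an allowable sequence *)

Section Assembly.
Variables (P : finType) (B : {set P}) (pi : int -> seq P).
Hypothesis pi_allowable : allowable pi.
Hypothesis even_P : ~~ odd (#|B| + #|~: B|).

Let n := #|P|.
Let N := 'C(n, 2).
Let c : pred P := fun x => x \in B.
Let d := delta B.
Let rho (t : nat) := pi t%:Z%R.

Lemma weight_colour : weight B =1 colour_weight c.
Proof. by move=> x; rewrite /weight /colour_weight. Qed.

Lemma rho_perm t : perm_eq (rho t) (enum P).
Proof. by case: pi_allowable => perm_pi _ _; apply: perm_pi. Qed.

Lemma rho_size t : size (rho t) = n.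
Proof. by rewrite (perm_size (rho_perm t)) -cardT. Qed.

Lemma rho_rev t : rho (t + N) = rev (rho t).
Proof. by case: pi_allowable => _ _ rev_pi; rewrite -rev_pi /rho PoszD. Qed.

Lemma rho_swap : exists (u v : nat -> seq P) (p q : nat -> P), forall t,
  rho t = u t ++ [:: p t, q t & v t] /\ rho t.+1 = u t ++ [:: q t, p t & v t].
Proof.
have /choice[g gP] : forall t, exists g : seq P * seq P * P * P,
    let: (u, v, p, q) := g in
    rho t = u ++ [:: p, q & v] /\ rho t.+1 = u ++ [:: q, p & v].
  move=> t; case: pi_allowable => _ /(_ (t.+1%:Z)%R) [u [p [q [v [def_s def_s']]]]] _.
  by exists (u, v, p, q); split=> //; rewrite -def_s /rho -addn1 PoszD addrK.
exists (fun t => (g t).1.1.1), (fun t => (g t).1.1.2).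
exists (fun t => (g t).1.2), (fun t => (g t).2).
by move=> t; have := gP t; case: (g t) => [[[u v] p] q].
Qed.

Lemma total_weight : prefix_weight c (enum P) n = (d + d)%R.
Proof.
rewrite /prefix_weight /n cardT take_size.
have -> : (\sum_(x <- enum P) colour_weight c x = #|B|%:Z - #|~: B|%:Z)%R.
  rewrite big_enum /= (bigID (mem B)) /=; congr (_ + _)%R.
    rewrite (eq_bigr (fun=> 1%R)) ?sumr_const ?natz // => x Bx.
    by rewrite /colour_weight /c Bx.
  rewrite (eq_bigr (fun=> (- 1)%R)) => [|x Bx]; last first.
    by rewrite /colour_weight /c /= (negbTE Bx).
  rewrite sumr_const mulNrn; congr (- _)%R.
  by rewrite natz; congr Posz; apply: eq_card => x; rewrite !inE.
rewrite /d /delta; move: even_P; lia.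
Qed.

(** A low letter in front and high letters behind complete the letters of the n
    points, in positions 1, ..., n. *)
Definition word t j : bool :=
  if j is i.+1 then (n <= i) || above c d (rho t) i else false.

Lemma word_reads t : reads c d (word t) (rho t).
Proof. by move=> i; rewrite rho_size /word ltnNge => /negbTE->. Qed.

Lemma word_mirror t j : j <= n.+1 -> word (t + N) j = ~~ word t (n.+1 - j).
Proof.
case: j => [_|i]; first by rewrite subn0 /= leqnn.
rewrite ltnS leq_eqVlt => /predU1P[->|lt_in]; first by rewrite subnn /= leqnn.
rewrite subSS /= leqNgt lt_in rho_rev /= above_rev ?rho_size //; last first.
  rewrite -(rho_size t) (prefix_weight_perm c (rho_perm t)) -cardT.
  exact: total_weight.
have -> : n - i = (n - i.+1).+1 by lia.
have /negbTE/= -> // : ~~ (n <= n - i.+1); lia.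
Qed.

Section Swaps.
Variables (u v : nat -> seq P) (p q : nat -> P).
Hypothesis rho_uv : forall t,
  rho t = u t ++ [:: p t, q t & v t] /\ rho t.+1 = u t ++ [:: q t, p t & v t].

Definition balanced_at t := is_balanced c d (rho t) (u t) (p t) (q t).

Lemma word_step t : word t.+1 =1 word t \/
  exists k, word t k = word t k.+1 /\
    forall j, word t.+1 j = word t j (+) ((j == k) || (j == k.+1)).
Proof.
have [def_s def_s'] := rho_uv t; set k := size (u t).
have lt_kn : k.+1 < n by rewrite -(rho_size t) def_s size_cat /=; lia.
have above_t i : above c d (rho t.+1) i =
    above c d (rho t) i (+) (balanced_at t && ((i == k) || (i == k.+1))).
  by rewrite def_s' above_swap -def_s /balanced_at /is_balanced -andbA.
have [flip_t|no_flip] := boolP (balanced_at t); last first.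
  by left=> -[|i] //=; rewrite above_t (negbTE no_flip) addbF.
right; exists k.+1; split=> [|[|i] //=].
  rewrite /= [n <= k]leqNgt [n <= k.+1]leqNgt lt_kn (ltnW lt_kn) /= def_s.
  by apply: above_pair; case/andP: flip_t.
rewrite above_t flip_t !eqSS; case: leqP => //= le_ni.
by have -> : (i == k) || (i == k.+1) = false by lia.
Qed.

Lemma balanced_at_le t0 :
  \sum_(i < N) balanced_at (t0 + i) <= #|balanced_pairs B pi|.
Proof.
pose e (i : 'I_N) := [set p (t0 + i); q (t0 + i)].
have inj_e : injective e.
  apply: (@swapped_pairs_inj P (fun i => rho (t0 + i)) (fun i => u (t0 + i))
    (fun i => v (t0 + i)) (fun i => p (t0 + i)) (fun i => q (t0 + i))).
  - by move=> t; apply: rho_perm.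
  - by rewrite addn0 rho_rev.
  - by move=> t; rewrite addnS; apply: rho_uv.
rewrite -big_mkcond /= sum1_card -(card_imset _ inj_e).
apply/subset_leq_card/subsetP => _ /imsetP[i i_flip ->].
have flip_i : balanced_at (t0 + i) by exact: i_flip.
rewrite inE; apply/asboolP;
  exists ((t0 + i).+1%:Z)%R, (p (t0 + i)), (q (t0 + i)).
split=> //; exists (u (t0 + i)); have [def_s def_s'] := rho_uv (t0 + i).
have [ne_c /eqP eq_d] := andP flip_i.
split=> //.
  exists (v (t0 + i)); rewrite -def_s -def_s'; split=> //.
  by rewrite /rho -addn1 PoszD addrK.
rewrite -[RHS]eq_d def_s prefix_weight_cat.
by apply: eq_bigr => x _; apply: weight_colour.
Qed.

(** Red points cross a symmetric path of valleys.  For a symmetric path of peaks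
    time is reversed and the colours are exchanged, so that peaks become valleys
    and blue points cross. *)
Lemma balanced_at_ge :
  exists t0, minn #|B| #|~: B| <= \sum_(i < N) balanced_at (t0 + i).
Proof.
have word_high t j : n < j -> word t j by case: j => // i /=; rewrite ltnS => ->.
have word_low t : ~~ word t 0 by [].
have [[t [z [z_N path]]]|[e [e_N path]]] :=
  symmetric_boundary word_low word_high word_step word_mirror.
- exists t; apply: leq_trans (geq_minr _ _) _.
  have -> : #|~: B| = #|[pred x | ~~ c x]| by apply: eq_card => x; rewrite !inE.
  apply: (@transport _ c d n N (fun i => rho (t + i)) (fun i => word (t + i)) z
    (fun i => balanced_at (t + i))).
  - by [].
  - exact: total_weight.
  - by move=> i; apply: rho_perm.
  - by rewrite addn0 rho_rev.
  - move=> i _; exists (u (t + i)), (v (t + i)), (p (t + i)), (q (t + i)).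
    by rewrite addnS; have [? ?] := rho_uv (t + i).
  - by move=> i; apply: word_reads.
  - by move=> i _; rewrite addnS; apply: path.
  - by have [vz _] := path 0; exact: (valley_le word_high vz).
  - by [].
have le_e t : e t <= n by have [pe _] := path t; exact: (peak_le word_high pe).
exists 0; apply: leq_trans (geq_minl _ _) _.
have -> : #|B| = #|[pred x | ~~ predC c x]|.
  by apply: eq_card => x; rewrite !inE negbK.
rewrite (reindex_inj rev_ord_inj) /=.
apply: (@transport _ (predC c) (- d)%R n N (fun i => rho (N - i))
  (fun i j => ~~ word (N - i) j) (fun i => e (N - i))
  (fun i => balanced_at (N - i.+1))).
- by [].
- by rewrite prefix_weightN total_weight opprD.
- by move=> i; apply: rho_perm.
- by rewrite subnn subn0 -[N]add0n rho_rev revK.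
- move=> i lt_i; set t := N - i.+1.
  have -> : N - i = t.+1 by lia.
  exists (u t), (v t), (q t), (p t); have [def_s def_s'] := rho_uv t.
  split=> //; rewrite /balanced_at /is_balanced prefix_weightN def_s def_s'.
  rewrite !prefix_weight_cat.
  congr (_ && _); last by rewrite eqr_opp.
  have neq_negb (a b : bool) : (a != b) = (~~ b != ~~ a) by case: a; case: b.
  exact: neq_negb.
- by move=> i j lt_j; rewrite word_reads // aboveN.
- move=> i lt_i; have [pk _] := path (N - i); split.
    by rewrite /valley negbK.
  have -> : N - i = (N - i.+1).+1 by lia.
  by have [_] := path (N - i.+1).
- exact: le_e.
- by rewrite subnn subn0 e_N subKn.
Qed.

End Swaps.
End Assembly.

Theorem theorem2p2 (b r : nat) (P : finType) (B : {set P})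
    (pi : int -> seq P) (hb : #|B| = b) (hr : #|~: B| = r)
    (hpi : allowable pi) (hbr : r <= b) (heven : ~~ odd (b + r)) :
  r <= #|balanced_pairs B pi|.
Proof.
have even_P : ~~ odd (#|B| + #|~: B|) by rewrite hb hr.
have [u [v [p [q swap_t]]]] := rho_swap hpi.
have [t le_flips] := balanced_at_ge hpi even_P swap_t.
rewrite -hr in hbr *; rewrite -hb in hbr.
have /minn_idPr min_r := hbr; rewrite min_r in le_flips.
apply: leq_trans le_flips _; exact: (balanced_at_le B hpi swap_t).
Qed.
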